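(* Let $\mathbb{H}=(\bar H=(H,e_H,m_H),\underline{H}=(H,\varepsilon_H,\delta_H),S)$ be a Hopf algebra in $\mathcal V$. Then the functor $$\mathcal V\to\mathcal V^{\mathbb H}_{\mathbb H},\qquad V\mapsto V\otimes H,$$ is an equivalence of categories.
   Context: $\mathcal V=(V,\otimes,I)$ is a strict braided monoidal category with braiding $\sigma_{X,Y}:X\otimes Y\to Y\otimes X$, with equalizers and with coequalizers, and the tensor product preserves coequalizers in both variables. The name of an object also denotes its identity morphism. The tensor product of algebras $A,B$ is an algebra with $m_{A\otimes B}=(m_A\otimes m_B)(A\otimes\sigma_{B,A}\otimes B)$ and $e_{A\otimes B}=e_A\otimes e_B$. A bialgebra is an object $H$ with an algebra structure $\bar H=(H,e_H,m_H)$ and a coalgebra structure $\underline H=(H,\varepsilon_H,\delta_H)$ such that $\varepsilon_H$ and $\delta_H$ are algebra morphisms. A Hopf algebra is a bialgebra with a morphism $S:H\to H$ (antipode) such that $m_H(H\otimes S)\delta_H=m_H(S\otimes H)\delta_H=e_H\varepsilon_H$. $\mathcal V^{\mathbb H}_{\mathbb H}$ is the category of objects $X$ with a right $\bar H$-module structure $\xi_X:X\otimes H\to X$ and a right $\underline H$-comodule structure $\nu_X:X\to X\otimes H$ satisfying $\nu_X\xi_X=(\xi_X\otimes m_H)(X\otimes\sigma_{H,H}\otimes H)(\nu_X\otimes\delta_H)$; morphisms are the right $\bar H$-module right $\underline H$-comodule morphisms. The object $V\otimes H$ carries the module structure $V\otimes m_H$ and the comodule structure $V\otimes\delta_H$.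 *)

(* Defs.v *)
From Stdlib Require Import ProofIrrelevance.
From Corelib Require Import ssreflect.

Set Implicit Arguments.
Unset Strict Implicit.
Unset Printing Implicit Defensive.

Record category := Category {
  ob :> Type;
  hom : ob -> ob -> Type;
  idm : forall X : ob, hom X X;
  comp : forall X Y Z : ob, hom Y Z -> hom X Y -> hom X Z;
  comp_idl : forall (X Y : ob) (f : hom X Y), comp (idm Y) f = f;
  comp_idr : forall (X Y : ob) (f : hom X Y), comp f (idm X) = f;
  compA : forall (W X Y Z : ob) (h : hom Y Z) (g : hom X Y) (f : hom W X),
    comp h (comp g f) = comp (comp h g) f
}.
Arguments hom {c} X Y.
Arguments idm {c} X.
Arguments comp {c X Y Z} g f.

Declare Scope cat_scope.
Delimit Scope cat_scope with cat.
Local Open Scope cat_scope.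
Notation "g ∘ f" := (comp g f) (at level 40, left associativity) : cat_scope.

Definition is_iso (C : category) (X Y : C) (f : hom X Y) : Prop :=
  exists g : hom Y X, g ∘ f = idm X /\ f ∘ g = idm Y.

Record functor (C D : category) := Functor {
  fobj :> C -> D;
  fmap : forall X Y : C, hom X Y -> hom (fobj X) (fobj Y);
  fmap_id : forall X : C, fmap (idm X) = idm (fobj X);
  fmap_comp : forall (X Y Z : C) (g : hom Y Z) (f : hom X Y),
    fmap (g ∘ f) = fmap g ∘ fmap f
}.
Arguments fmap {C D} F {X Y} f : rename.

Definition id_functor (C : category) : functor C C :=
  @Functor C C (fun X => X) (fun _ _ f => f)
    (fun _ => eq_refl) (fun _ _ _ _ _ => eq_refl).

Lemma comp_functor_id (C D E : category) (G : functor D E) (F : functor C D)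
  (X : C) : fmap G (fmap F (idm X)) = idm (G (F X)).
Proof. by rewrite !fmap_id. Qed.

Lemma comp_functor_comp (C D E : category) (G : functor D E) (F : functor C D)
  (X Y Z : C) (g : hom Y Z) (f : hom X Y) :
  fmap G (fmap F (g ∘ f)) = fmap G (fmap F g) ∘ fmap G (fmap F f).
Proof. by rewrite !fmap_comp. Qed.

Definition comp_functor (C D E : category) (G : functor D E) (F : functor C D) :
  functor C E :=
  @Functor C E (fun X => G (F X)) (fun _ _ f => fmap G (fmap F f))
    (comp_functor_id G F) (comp_functor_comp G F).

Definition nat_isomorphic (C D : category) (F G : functor C D) : Prop :=
  exists t : forall X : C, hom (F X) (G X),
    (forall (X Y : C) (f : hom X Y), t Y ∘ fmap F f = fmap G f ∘ t X) /\
    (forall X : C, is_iso (t X)).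

Definition is_equivalence (C D : category) (F : functor C D) : Prop :=
  exists G : functor D C,
    nat_isomorphic (comp_functor G F) (id_functor C) /\
    nat_isomorphic (comp_functor F G) (id_functor D).

Definition is_equalizer (C : category) (X Y : C) (f g : hom X Y)
    (E : C) (e : hom E X) : Prop :=
  f ∘ e = g ∘ e /\
  forall (T : C) (t : hom T X), f ∘ t = g ∘ t ->
    exists! u : hom T E, e ∘ u = t.

Definition is_coequalizer (C : category) (X Y : C) (f g : hom X Y)
    (Q : C) (q : hom Y Q) : Prop :=
  q ∘ f = q ∘ g /\
  forall (T : C) (t : hom Y T), t ∘ f = t ∘ g ->
    exists! u : hom Q T, u ∘ q = t.

Definition has_equalizers (C : category) : Prop :=
  forall (X Y : C) (f g : hom X Y),
    exists (E : C) (e : hom E X), is_equalizer f g e.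

Definition has_coequalizers (C : category) : Prop :=
  forall (X Y : C) (f g : hom X Y),
    exists (Q : C) (q : hom Y Q), is_coequalizer f g q.

(** Strictness is equality of objects such as [(X ⊗ Y) ⊗ Z = X ⊗ (Y ⊗ Z)].
    As this is not a definitional equality, morphisms are transported along it
    by composing with [cast e], the identity morphism seen as a morphism
    between two equal objects.  By proof irrelevance [cast e] only depends on
    its source and target, hence no coherence axiom is needed. *)
Definition cast (C : category) (X Y : C) (e : X = Y) : hom X Y :=
  match e in _ = Z return hom X Z with eq_refl => idm X end.

Reserved Notation "X ⊗ Y" (at level 36, left associativity).
Reserved Notation "f ⊗₁ g" (at level 36, left associativity).

Record strict_monoidal := StrictMonoidal {
  sm_cat :> category;
  tens : sm_cat -> sm_cat -> sm_cat where "X ⊗ Y" := (tens X Y);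
  tensm : forall X X' Y Y' : sm_cat,
    hom X X' -> hom Y Y' -> hom (X ⊗ Y) (X' ⊗ Y')
    where "f ⊗₁ g" := (tensm f g);
  unit_ob : sm_cat;
  tensm_id : forall X Y : sm_cat, idm X ⊗₁ idm Y = idm (X ⊗ Y);
  tensm_comp : forall (X X' X'' Y Y' Y'' : sm_cat)
      (f' : hom X' X'') (f : hom X X') (g' : hom Y' Y'') (g : hom Y Y'),
    (f' ∘ f) ⊗₁ (g' ∘ g) = (f' ⊗₁ g') ∘ (f ⊗₁ g);
  tensA : forall X Y Z : sm_cat, (X ⊗ Y) ⊗ Z = X ⊗ (Y ⊗ Z);
  tens1l : forall X : sm_cat, unit_ob ⊗ X = X;
  tens1r : forall X : sm_cat, X ⊗ unit_ob = X;
  tensmA : forall (X X' Y Y' Z Z' : sm_cat)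
      (f : hom X X') (g : hom Y Y') (h : hom Z Z'),
    cast (tensA X' Y' Z') ∘ ((f ⊗₁ g) ⊗₁ h) =
    (f ⊗₁ (g ⊗₁ h)) ∘ cast (tensA X Y Z);
  tensm1l : forall (X X' : sm_cat) (f : hom X X'),
    cast (tens1l X') ∘ (idm unit_ob ⊗₁ f) = f ∘ cast (tens1l X);
  tensm1r : forall (X X' : sm_cat) (f : hom X X'),
    cast (tens1r X') ∘ (f ⊗₁ idm unit_ob) = f ∘ cast (tens1r X)
}.
Arguments tens {s} X Y.
Arguments tensm {s X X' Y Y'} f g.
Arguments unit_ob {s}.

Notation "X ⊗ Y" := (tens X Y) : cat_scope.
Notation "f ⊗₁ g" := (tensm f g) : cat_scope.

Definition assoc (V : strict_monoidal) (X Y Z : V) :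
  hom ((X ⊗ Y) ⊗ Z) (X ⊗ (Y ⊗ Z)) := cast (tensA X Y Z).
Definition assoc_inv (V : strict_monoidal) (X Y Z : V) :
  hom (X ⊗ (Y ⊗ Z)) ((X ⊗ Y) ⊗ Z) := cast (eq_sym (tensA X Y Z)).
Definition lunit (V : strict_monoidal) (X : V) : hom (unit_ob ⊗ X) X :=
  cast (tens1l X).
Definition runit (V : strict_monoidal) (X : V) : hom (X ⊗ unit_ob) X :=
  cast (tens1r X).

(** The last two fields are the hexagon identities, which for a strict monoidal
    category read [σ_{X,Y⊗Z} = (Y ⊗ σ_{X,Z}) (σ_{X,Y} ⊗ Z)] and
    [σ_{X⊗Y,Z} = (σ_{X,Z} ⊗ Y) (X ⊗ σ_{Y,Z})]. *)
Record strict_braided := StrictBraided {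
  sb_monoidal :> strict_monoidal;
  braid : forall X Y : sb_monoidal, hom (X ⊗ Y) (Y ⊗ X);
  braid_iso : forall X Y : sb_monoidal, is_iso (braid X Y);
  braid_nat : forall (X X' Y Y' : sb_monoidal) (f : hom X X') (g : hom Y Y'),
    braid X' Y' ∘ (f ⊗₁ g) = (g ⊗₁ f) ∘ braid X Y;
  braid_tensr : forall X Y Z : sb_monoidal,
    assoc Y Z X ∘ braid X (Y ⊗ Z) ∘ assoc X Y Z =
    (idm Y ⊗₁ braid X Z) ∘ assoc Y X Z ∘ (braid X Y ⊗₁ idm Z);
  braid_tensl : forall X Y Z : sb_monoidal,
    assoc_inv Z X Y ∘ braid (X ⊗ Y) Z ∘ assoc_inv X Y Z =
    (braid X Z ⊗₁ idm Y) ∘ assoc_inv X Z Y ∘ (idm X ⊗₁ braid Y Z)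
}.
Arguments braid {s} X Y.

Definition tensor_preserves_coequalizers (V : strict_monoidal) : Prop :=
  forall (X Y : V) (f g : hom X Y) (Q : V) (q : hom Y Q) (Z : V),
    is_coequalizer f g q ->
    is_coequalizer (idm Z ⊗₁ f) (idm Z ⊗₁ g) (idm Z ⊗₁ q) /\
    is_coequalizer (f ⊗₁ idm Z) (g ⊗₁ idm Z) (q ⊗₁ idm Z).

Record alg_ops (V : strict_monoidal) (A : V) := AlgOps {
  alg_e : hom unit_ob A;
  alg_m : hom (A ⊗ A) A
}.

Record is_algebra (V : strict_monoidal) (A : V) (a : alg_ops A) : Prop := {
  alg_mA : alg_m a ∘ (alg_m a ⊗₁ idm A) =
           alg_m a ∘ (idm A ⊗₁ alg_m a) ∘ assoc A A A;
  alg_m1l : alg_m a ∘ (alg_e a ⊗₁ idm A) = lunit A;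
  alg_m1r : alg_m a ∘ (idm A ⊗₁ alg_e a) = runit A
}.

Record coalg_ops (V : strict_monoidal) (C : V) := CoalgOps {
  coalg_eps : hom C unit_ob;
  coalg_delta : hom C (C ⊗ C)
}.

Record is_coalgebra (V : strict_monoidal) (C : V) (c : coalg_ops C) : Prop := {
  coalg_deltaA : assoc C C C ∘ (coalg_delta c ⊗₁ idm C) ∘ coalg_delta c =
                 (idm C ⊗₁ coalg_delta c) ∘ coalg_delta c;
  coalg_delta1l : lunit C ∘ (coalg_eps c ⊗₁ idm C) ∘ coalg_delta c = idm C;
  coalg_delta1r : runit C ∘ (idm C ⊗₁ coalg_eps c) ∘ coalg_delta c = idm C
}.

Definition is_alg_morphism (V : strict_monoidal) (A B : V)
    (a : alg_ops A) (b : alg_ops B) (f : hom A B) : Prop :=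
  f ∘ alg_e a = alg_e b /\ f ∘ alg_m a = alg_m b ∘ (f ⊗₁ f).

Definition unit_alg (V : strict_monoidal) : alg_ops (@unit_ob V) :=
  AlgOps (idm unit_ob) (lunit unit_ob).

(** [A ⊗ σ_{B,C} ⊗ D]. *)
Definition middle_braid (V : strict_braided) (A B C D : V) :
    hom ((A ⊗ B) ⊗ (C ⊗ D)) ((A ⊗ C) ⊗ (B ⊗ D)) :=
  assoc_inv A C (B ⊗ D) ∘ (idm A ⊗₁ assoc C B D)
  ∘ (idm A ⊗₁ (braid B C ⊗₁ idm D))
  ∘ (idm A ⊗₁ assoc_inv B C D) ∘ assoc A B (C ⊗ D).

Definition tens_alg (V : strict_braided) (A B : V)
    (a : alg_ops A) (b : alg_ops B) : alg_ops (A ⊗ B) :=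
  AlgOps
    ((alg_e a ⊗₁ alg_e b) ∘ cast (eq_sym (tens1l unit_ob)))
    ((alg_m a ⊗₁ alg_m b) ∘ middle_braid A B A B).

Record bialgebra (V : strict_braided) := Bialgebra {
  bi_ob :> V;
  bi_alg : alg_ops bi_ob;
  bi_coalg : coalg_ops bi_ob;
  bi_algP : is_algebra bi_alg;
  bi_coalgP : is_coalgebra bi_coalg;
  bi_eps_alg : is_alg_morphism bi_alg (unit_alg V) (coalg_eps bi_coalg);
  bi_delta_alg :
    is_alg_morphism bi_alg (tens_alg bi_alg bi_alg) (coalg_delta bi_coalg)
}.

Definition bi_e (V : strict_braided) (H : bialgebra V) : hom unit_ob H :=
  alg_e (bi_alg H).
Definition bi_m (V : strict_braided) (H : bialgebra V) : hom (H ⊗ H) H :=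
  alg_m (bi_alg H).
Definition bi_eps (V : strict_braided) (H : bialgebra V) : hom H unit_ob :=
  coalg_eps (bi_coalg H).
Definition bi_delta (V : strict_braided) (H : bialgebra V) : hom H (H ⊗ H) :=
  coalg_delta (bi_coalg H).

Record hopf_algebra (V : strict_braided) := HopfAlgebra {
  hopf_bialgebra :> bialgebra V;
  antipode : hom hopf_bialgebra hopf_bialgebra;
  antipode_r :
    bi_m hopf_bialgebra ∘ (idm hopf_bialgebra ⊗₁ antipode)
      ∘ bi_delta hopf_bialgebra = bi_e hopf_bialgebra ∘ bi_eps hopf_bialgebra;
  antipode_l :
    bi_m hopf_bialgebra ∘ (antipode ⊗₁ idm hopf_bialgebra)
      ∘ bi_delta hopf_bialgebra = bi_e hopf_bialgebra ∘ bi_eps hopf_bialgebra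
}.

Record is_right_module (V : strict_monoidal) (A : V) (a : alg_ops A)
    (X : V) (xi : hom (X ⊗ A) X) : Prop := {
  rmodA : xi ∘ (xi ⊗₁ idm A) = xi ∘ (idm X ⊗₁ alg_m a) ∘ assoc X A A;
  rmod1 : xi ∘ (idm X ⊗₁ alg_e a) = runit X
}.

Record is_right_comodule (V : strict_monoidal) (C : V) (c : coalg_ops C)
    (X : V) (nu : hom X (X ⊗ C)) : Prop := {
  rcomodA : assoc X C C ∘ (nu ⊗₁ idm C) ∘ nu =
            (idm X ⊗₁ coalg_delta c) ∘ nu;
  rcomod1 : runit X ∘ (idm X ⊗₁ coalg_eps c) ∘ nu = idm X
}.

Record hopf_module (V : strict_braided) (H : bialgebra V) := HopfModule {
  hm_ob :> V;
  hm_xi : hom (hm_ob ⊗ H) hm_ob;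
  hm_nu : hom hm_ob (hm_ob ⊗ H);
  hm_module : is_right_module (bi_alg H) hm_xi;
  hm_comodule : is_right_comodule (bi_coalg H) hm_nu;
  hm_compat : hm_nu ∘ hm_xi =
    (hm_xi ⊗₁ bi_m H) ∘ middle_braid hm_ob H H H ∘ (hm_nu ⊗₁ bi_delta H)
}.
Arguments hm_xi {V H} h.
Arguments hm_nu {V H} h.

Record hopf_module_hom (V : strict_braided) (H : bialgebra V)
    (X Y : hopf_module H) := HopfModuleHom {
  hmh_mor :> hom (hm_ob X) (hm_ob Y);
  hmh_module : hmh_mor ∘ hm_xi X = hm_xi Y ∘ (hmh_mor ⊗₁ idm H);
  hmh_comodule : hm_nu Y ∘ hmh_mor = (hmh_mor ⊗₁ idm H) ∘ hm_nu X
}.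

Lemma hopf_module_hom_eq (V : strict_braided) (H : bialgebra V)
  (X Y : hopf_module H) (f g : hopf_module_hom X Y) :
  hmh_mor f = hmh_mor g -> f = g.
Proof.
case: f g => [f f1 f2] [g g1 g2] /= E; subst g.
by rewrite (proof_irrelevance _ f1 g1) (proof_irrelevance _ f2 g2).
Qed.

Lemma tens_idr_comp (V : strict_monoidal) (X Y Z W : V)
  (g : hom Y Z) (f : hom X Y) :
  (g ∘ f) ⊗₁ idm W = (g ⊗₁ idm W) ∘ (f ⊗₁ idm W).
Proof. by rewrite -tensm_comp comp_idl. Qed.

Lemma tens_idl_comp (V : strict_monoidal) (X Y Z W : V)
  (g : hom Y Z) (f : hom X Y) :
  idm W ⊗₁ (g ∘ f) = (idm W ⊗₁ g) ∘ (idm W ⊗₁ f).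
Proof. by rewrite -tensm_comp comp_idl. Qed.

Section HopfModuleCategory.
Context (V : strict_braided) (H : bialgebra V).

Definition hmh_id (X : hopf_module H) : hopf_module_hom X X.
Proof.
exists (idm (hm_ob X)).
- by rewrite comp_idl tensm_id comp_idr.
- by rewrite comp_idr tensm_id comp_idl.
Defined.

Definition hmh_comp (X Y Z : hopf_module H)
  (g : hopf_module_hom Y Z) (f : hopf_module_hom X Y) : hopf_module_hom X Z.
Proof.
exists (hmh_mor g ∘ hmh_mor f).
- by rewrite tens_idr_comp -compA hmh_module !compA hmh_module.
- by rewrite tens_idr_comp compA hmh_comodule -!compA hmh_comodule.
Defined.

Lemma hmh_comp_idl (X Y : hopf_module H) (f : hopf_module_hom X Y) :
  hmh_comp (hmh_id Y) f = f.
Proof. by apply: hopf_module_hom_eq; apply: comp_idl. Qed.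

Lemma hmh_comp_idr (X Y : hopf_module H) (f : hopf_module_hom X Y) :
  hmh_comp f (hmh_id X) = f.
Proof. by apply: hopf_module_hom_eq; apply: comp_idr. Qed.

Lemma hmh_compA (W X Y Z : hopf_module H) (h : hopf_module_hom Y Z)
  (g : hopf_module_hom X Y) (f : hopf_module_hom W X) :
  hmh_comp h (hmh_comp g f) = hmh_comp (hmh_comp h g) f.
Proof. by apply: hopf_module_hom_eq; apply: compA. Qed.

Definition hopf_modules : category :=
  @Category (hopf_module H) (@hopf_module_hom V H) hmh_id hmh_comp
    hmh_comp_idl hmh_comp_idr hmh_compA.

End HopfModuleCategory.

Section CastFacts.
Context (V : strict_monoidal).
Implicit Types X Y Z : V.

Lemma cast_id X (e : X = X) : cast e = idm X.
Proof. by rewrite (proof_irrelevance _ e eq_refl). Qed.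

Lemma cast_irr X Y (e e' : X = Y) : cast e = cast e'.
Proof. by rewrite (proof_irrelevance _ e e'). Qed.

Lemma cast_comp X Y Z (e' : Y = Z) (e : X = Y) :
  cast e' ∘ cast e = cast (eq_trans e e').
Proof. by destruct e'; rewrite /= comp_idl. Qed.

Lemma cast_comp_l W X Y Z (e' : Y = Z) (e : X = Y) (f : hom W X) :
  cast e' ∘ (cast e ∘ f) = cast (eq_trans e e') ∘ f.
Proof. by rewrite compA cast_comp. Qed.

Lemma tens_cast_r X Y Z (e : X = Y) :
  cast e ⊗₁ idm Z = cast (f_equal (fun T => T ⊗ Z) e).
Proof. by destruct e; rewrite /= tensm_id. Qed.

Lemma tens_cast_l X Y Z (e : X = Y) :
  idm Z ⊗₁ cast e = cast (f_equal (fun T => Z ⊗ T) e).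
Proof. by destruct e; rewrite /= tensm_id. Qed.

Lemma assoc_nat X X' Y Y' Z Z' (f : hom X X') (g : hom Y Y') (h : hom Z Z') :
  assoc X' Y' Z' ∘ ((f ⊗₁ g) ⊗₁ h) = (f ⊗₁ (g ⊗₁ h)) ∘ assoc X Y Z.
Proof. exact: tensmA. Qed.

Lemma assocK X Y Z : assoc_inv X Y Z ∘ assoc X Y Z = idm _.
Proof. by rewrite /assoc /assoc_inv cast_comp cast_id. Qed.

Lemma assoc_invK X Y Z : assoc X Y Z ∘ assoc_inv X Y Z = idm _.
Proof. by rewrite /assoc /assoc_inv cast_comp cast_id. Qed.

Lemma assoc_inv_nat X X' Y Y' Z Z'
  (f : hom X X') (g : hom Y Y') (h : hom Z Z') :
  assoc_inv X' Y' Z' ∘ (f ⊗₁ (g ⊗₁ h)) = ((f ⊗₁ g) ⊗₁ h) ∘ assoc_inv X Y Z.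
Proof.
rewrite -[LHS]comp_idr -(assoc_invK X Y Z) compA -(compA _ _ (assoc X Y Z)).
by rewrite -assoc_nat compA assocK comp_idl.
Qed.

End CastFacts.

Section FreeHopfModule.
Context (V : strict_braided) (H : bialgebra V).

Definition free_xi (W : V) : hom ((W ⊗ H) ⊗ H) (W ⊗ H) :=
  (idm W ⊗₁ bi_m H) ∘ assoc W H H.

Definition free_nu (W : V) : hom (W ⊗ H) ((W ⊗ H) ⊗ H) :=
  assoc_inv W H H ∘ (idm W ⊗₁ bi_delta H).

Lemma free_module (W : V) : is_right_module (bi_alg H) (free_xi W).
Proof.
have [mA _ m1] := bi_algP H.
split; rewrite /free_xi /bi_m.
- rewrite tens_idr_comp -!compA.
  rewrite (compA (assoc W H H) ((idm W ⊗₁ _) ⊗₁ idm H)) assoc_nat.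
  rewrite -(tensm_id W H) (compA (assoc W H H) ((idm W ⊗₁ idm H) ⊗₁ _)) assoc_nat.
  rewrite -!compA !(compA (idm W ⊗₁ alg_m _)) -!tens_idl_comp mA.
  rewrite tens_idl_comp -!compA; congr (_ ∘ _).
  rewrite /assoc tens_cast_r tens_cast_l !cast_comp; exact: cast_irr.
- rewrite -compA -(tensm_id W H) assoc_nat compA -tens_idl_comp m1.
  rewrite /assoc /runit tens_cast_l cast_comp; exact: cast_irr.
Qed.

Lemma free_comodule (W : V) : is_right_comodule (bi_coalg H) (free_nu W).
Proof.
have [dA _ d1] := bi_coalgP H.
split; rewrite /free_nu /bi_delta.
- rewrite tens_idr_comp -!compA.
  rewrite (compA _ (assoc_inv W H H)) -assoc_inv_nat.
  rewrite -(tensm_id W H) (compA _ (assoc_inv W H H)) -assoc_inv_nat.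
  rewrite -!compA -!tens_idl_comp -dA !tens_idl_comp !compA.
  congr (_ ∘ _ ∘ _).
  rewrite /assoc /assoc_inv tens_cast_r tens_cast_l !cast_comp; exact: cast_irr.
- rewrite -(tensm_id W H) -compA (compA _ (assoc_inv W H H)) -assoc_inv_nat.
  rewrite -compA -tens_idl_comp compA.
  have -> : runit (W ⊗ H) ∘ assoc_inv W H unit_ob = idm W ⊗₁ runit H.
    rewrite /assoc_inv /runit tens_cast_l cast_comp; exact: cast_irr.
  by rewrite -tens_idl_comp compA d1 tensm_id.
Qed.

Lemma free_middle_braid (W A B C D : V) :
  assoc_inv W (A ⊗ C) (B ⊗ D) ∘ (idm W ⊗₁ middle_braid A B C D)
    ∘ assoc W (A ⊗ B) (C ⊗ D) =
  (assoc W A C ⊗₁ idm (B ⊗ D)) ∘ middle_braid (W ⊗ A) B C D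
    ∘ (assoc_inv W A B ⊗₁ idm (C ⊗ D)).
Proof.
have -> : idm W ⊗₁ middle_braid A B C D =
   (idm W ⊗₁ (assoc_inv A C (B ⊗ D) ∘ (idm A ⊗₁ assoc C B D)))
   ∘ (idm W ⊗₁ (idm A ⊗₁ (braid B C ⊗₁ idm D)))
   ∘ (idm W ⊗₁ ((idm A ⊗₁ assoc_inv B C D) ∘ assoc A B (C ⊗ D))).
  by rewrite -!tens_idl_comp /middle_braid !compA.
have E : idm W ⊗₁ (idm A ⊗₁ (braid B C ⊗₁ idm D)) =
   assoc _ _ _ ∘ (idm (W ⊗ A) ⊗₁ (braid B C ⊗₁ idm D)) ∘ assoc_inv _ _ _.
  by rewrite -(tensm_id W A) assoc_nat -compA assoc_invK comp_idr.
rewrite E /middle_braid /assoc /assoc_inv !tens_cast_l !cast_comp.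
rewrite !tens_cast_l !tens_cast_r -!compA !cast_comp !cast_comp_l.
by apply: f_equal2; [|apply: f_equal]; apply: cast_irr.
Qed.

Lemma free_compat (W : V) :
  free_nu W ∘ free_xi W =
  (free_xi W ⊗₁ bi_m H) ∘ middle_braid (W ⊗ H) H H H
    ∘ (free_nu W ⊗₁ bi_delta H).
Proof.
have [_ dm] := bi_delta_alg H.
rewrite /free_nu /free_xi /bi_m /bi_delta.
have -> : ((idm W ⊗₁ alg_m (bi_alg H)) ∘ assoc W H H) ⊗₁ alg_m (bi_alg H) =
  ((idm W ⊗₁ alg_m (bi_alg H)) ⊗₁ alg_m (bi_alg H))
    ∘ (assoc W H H ⊗₁ idm (H ⊗ H)).
  by rewrite -tensm_comp comp_idr.
have -> : (assoc_inv W H H ∘ (idm W ⊗₁ coalg_delta (bi_coalg H)))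
    ⊗₁ coalg_delta (bi_coalg H) =
  (assoc_inv W H H ⊗₁ idm (H ⊗ H)) ∘
  ((idm W ⊗₁ coalg_delta (bi_coalg H)) ⊗₁ coalg_delta (bi_coalg H)).
  by rewrite -tensm_comp comp_idl.
rewrite -(compA (_ ⊗₁ _) (_ ⊗₁ _) (middle_braid _ _ _ _)) [RHS]compA.
rewrite -(compA (_ ⊗₁ _) _ (assoc_inv W H H ⊗₁ _)) -free_middle_braid.
rewrite -!compA (compA (idm W ⊗₁ coalg_delta _)) -tens_idl_comp dm /=.
rewrite assoc_nat !tens_idl_comp !compA -assoc_inv_nat.
by rewrite -!compA.
Qed.

Definition free_hopf_module_ob (W : V) : hopf_modules H :=
  HopfModule (free_module W) (free_comodule W) (free_compat W).

Definition free_hopf_module_mor (W W' : V) (f : hom W W') :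
  hom (free_hopf_module_ob W) (free_hopf_module_ob W').
Proof.
exists (f ⊗₁ idm H).
- rewrite /= /free_xi -compA assoc_nat !compA tensm_id -!tensm_comp.
  by rewrite !comp_idl !comp_idr.
- rewrite /= /free_nu compA -assoc_inv_nat -!compA tensm_id -!tensm_comp.
  by rewrite !comp_idl !comp_idr.
Defined.

Lemma free_hopf_module_id (W : V) :
  free_hopf_module_mor (idm W) = idm (free_hopf_module_ob W).
Proof. by apply: hopf_module_hom_eq; apply: tensm_id. Qed.

Lemma free_hopf_module_comp (W W' W'' : V) (g : hom W' W'') (f : hom W W') :
  free_hopf_module_mor (g ∘ f) =
  free_hopf_module_mor g ∘ free_hopf_module_mor f.
Proof. by apply: hopf_module_hom_eq; apply: tens_idr_comp. Qed.

Definition free_hopf_module : functor V (hopf_modules H) :=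
  @Functor V (hopf_modules H) free_hopf_module_ob free_hopf_module_mor
    free_hopf_module_id free_hopf_module_comp.

End FreeHopfModule.

(* Main.v *)
Require Import Defs.
From Stdlib Require Import IndefiniteDescription.
From Corelib Require Import ssreflect.

Set Implicit Arguments.
Unset Strict Implicit.
Unset Printing Implicit Defensive.
Local Open Scope cat_scope.

(** The fundamental theorem of Hopf modules.  The quasi-inverse sends a Hopf
    module [X], with action [ξ] and coaction [ν], to its object [E] of
    coinvariants, the equalizer of [ν] and [x ↦ x ⊗ 1]; the counit of the
    equivalence is [φ : E ⊗ H → X], [x ⊗ h ↦ x h].

    Everything rests on the endomorphism [p x = x₀ S(x₁)] of [X].  It satisfies
    [p(x₀) x₁ = x] ([projection_act_coact]), it has coinvariant values
    ([projection_coinvariant]) and it fixes coinvariants ([projection_fixes]).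
    Hence [p] factors as [i r] through the inclusion [i] of [E] with [r i = 1],
    so [E] splits the idempotent [p].  The inverse of [φ] is
    [x ↦ r(x₀) ⊗ x₁]: one composite is the identity by the first property of
    [p], the other because [φ] is colinear and [p(φ(x ⊗ h)) = x ε(h)]
    ([projection_free_map]).  Conversely the coinvariants of [W ⊗ H] are the
    [w ⊗ 1], since [W ⊗ ε] applied to the equation of coinvariance recovers
    [x = (W ⊗ ε)(x) ⊗ 1].

    The delicate point is that [p] has coinvariant values.  Computing
    [ν(x₀ S(x₁))] directly would require the antipode to reverse the
    comultiplication, a long calculation with the braiding.  It is avoided as
    follows.  The map [β(x ⊗ h) = x h₁ ⊗ h₂] is linear from the free module
    [X ⊗ H] to [X ⊗ H] with the diagonal action ([galois_map_linear]), and
    [ν(x) = β(p(x₀) ⊗ x₁)] ([coact_galois]).  As [ν] is also linear for the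
    diagonal action,
    [ν(x₀ S(x₁)) = β(p(x₀) ⊗ x₁) S(x₂) = β(p(x₀) ⊗ x₁ S(x₂)) = β(p(x) ⊗ 1)
     = p(x) ⊗ 1].

    To keep the associativity casts of the monoidal category out of these
    arguments, they are written in terms of the endofunctor [T = - ⊗ H] and its
    natural transformations: multiplication [μ], unit [η], comultiplication
    [Δ], counit [ϵ] and antipode [s].  They compute as if the monoidal
    category were strict on the nose once the identities between these
    transformations are known. *)

(** * Rewriting in composites *)

Lemma comp_rewrite (C : category) (W X Y Z : C) (k : hom Y Z)
  (g : hom X Y) (f : hom W X) (h : hom W Y) :
  g ∘ f = h -> k ∘ g ∘ f = k ∘ h.
Proof. by move=> <-; rewrite compA. Qed.

(** Matching on syntax matters here: rewriting with [compA] works up to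
    unfolding, and would break open structure maps defined as composites. *)
Ltac assoc_left :=
  repeat match goal with
  | |- context [comp ?h (comp ?g ?f)] => rewrite (compA h g f)
  end.

(** * The functor of tensoring with a bialgebra *)

Section HopfMonad.
Context (V : strict_braided) (H : bialgebra V).

Local Notation T f := (f ⊗₁ idm (bi_ob H)).
Local Notation μ := (@free_xi V H).
Local Notation Δ := (@free_nu V H).

Definition unit_map (X : V) : hom X (X ⊗ H) :=
  (idm X ⊗₁ bi_e H) ∘ cast (eq_sym (tens1r X)).

Definition counit_map (X : V) : hom (X ⊗ H) X :=
  runit X ∘ (idm X ⊗₁ bi_eps H).

Local Notation η := unit_map.
Local Notation ϵ := counit_map.

Lemma free_xi_nat (X Y : V) (f : hom X Y) : μ Y ∘ T (T f) = T f ∘ μ X.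
Proof. exact: eq_sym (hmh_module (free_hopf_module_mor H f)). Qed.

Lemma free_nu_nat (X Y : V) (f : hom X Y) : Δ Y ∘ T f = T (T f) ∘ Δ X.
Proof. exact: (hmh_comodule (free_hopf_module_mor H f)). Qed.

Lemma unit_map_nat (X Y : V) (f : hom X Y) : T f ∘ η X = η Y ∘ f.
Proof.
have E : cast (eq_sym (tens1r Y)) ∘ f =
    (f ⊗₁ idm unit_ob) ∘ cast (eq_sym (tens1r X)).
  rewrite -[f in LHS]comp_idr -(cast_id (eq_trans (eq_sym (tens1r X)) (tens1r X))).
  rewrite -cast_comp (compA f) -tensm1r !compA cast_comp cast_id comp_idl.
  by [].
rewrite /η -(compA _ _ f) E !compA -!tensm_comp.
by rewrite !comp_idl !comp_idr.
Qed.

Lemma counit_map_nat (X Y : V) (f : hom X Y) : ϵ Y ∘ T f = f ∘ ϵ X.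
Proof.
rewrite /ϵ compA -tensm1r -!compA -!tensm_comp.
by rewrite !comp_idl !comp_idr.
Qed.

Lemma counit_unit_map (X : V) : ϵ X ∘ η X = idm X.
Proof.
have [Ee _] := bi_eps_alg H.
rewrite /ϵ /η compA (comp_rewrite _ (eq_sym (tens_idl_comp _ _ _))).
by rewrite /bi_eps /bi_e Ee tensm_id comp_idr cast_comp cast_id.
Qed.

Lemma free_nu_unit (X : V) : Δ X ∘ η X = T (η X) ∘ η X.
Proof.
have [de _] := bi_delta_alg H.
rewrite /free_nu /η /bi_delta /bi_e compA.
rewrite (comp_rewrite _ (eq_sym (tens_idl_comp _ _ _))) de /=.
rewrite tens_idl_comp compA assoc_inv_nat tens_idr_comp.
rewrite compA (comp_rewrite _ (eq_sym (tensm_comp _ _ _ _))) comp_idl comp_idr.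
have -> : cast (eq_sym (tens1r X)) ⊗₁ alg_e (bi_alg H) =
    (idm _ ⊗₁ alg_e (bi_alg H)) ∘ (cast (eq_sym (tens1r X)) ⊗₁ idm unit_ob).
  by rewrite -tensm_comp comp_idl comp_idr.
rewrite compA -tensm_comp comp_idr comp_idl -!compA; congr (_ ∘ _).
rewrite /assoc_inv tens_cast_l tens_cast_r !cast_comp; exact: cast_irr.
Qed.

(** Left unitality of the multiplication; right unitality is [module_unit]
    for the free module. *)
Lemma free_xi_unit (X : V) : μ X ∘ T (η X) = idm (X ⊗ H).
Proof.
have [_ m1 _] := bi_algP H.
rewrite /free_xi /η tens_idr_comp compA (comp_rewrite _ (assoc_nat _ _ _)).
rewrite compA -tens_idl_comp m1.
by rewrite /lunit /assoc tens_cast_l tens_cast_r !cast_comp cast_id.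
Qed.

Lemma counit_free_nu (X : V) : T (ϵ X) ∘ Δ X = idm (X ⊗ H).
Proof.
have [_ d1 _] := bi_coalgP H.
rewrite /free_nu /ϵ tens_idr_comp compA.
rewrite (comp_rewrite _ (eq_sym (assoc_inv_nat _ _ _))) compA.
have -> : T (runit X) ∘ assoc_inv X unit_ob H = idm X ⊗₁ lunit H.
  rewrite /runit /lunit /assoc_inv tens_cast_l tens_cast_r !cast_comp.
  exact: cast_irr.
by rewrite -!tens_idl_comp d1 tensm_id.
Qed.

Section Modules.
Variable X : V.

Section RightModule.
Variable ξ : hom (X ⊗ H) X.
Hypothesis ξP : is_right_module (bi_alg H) ξ.

Lemma module_assoc : ξ ∘ T ξ = ξ ∘ μ X.
Proof. by rewrite /free_xi compA; case: ξP. Qed.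

Lemma module_unit : ξ ∘ η X = idm X.
Proof.
by rewrite /η compA (rmod1 ξP) /runit cast_comp cast_id.
Qed.
End RightModule.

Section RightComodule.
Variable ν : hom X (X ⊗ H).
Hypothesis νP : is_right_comodule (bi_coalg H) ν.

Lemma comodule_coassoc : T ν ∘ ν = Δ X ∘ ν.
Proof.
by rewrite /free_nu -compA -(rcomodA νP) !compA assocK comp_idl.
Qed.

Lemma comodule_counit : ϵ X ∘ ν = idm X.
Proof. exact: (rcomod1 νP). Qed.
End RightComodule.
End Modules.

(** * Diagonal action and Galois map *)

Lemma middle_braid_nat_l (X Y B C D : V) (f : hom X Y) :
  middle_braid Y B C D ∘ ((f ⊗₁ idm B) ⊗₁ idm (C ⊗ D)) =
  ((f ⊗₁ idm C) ⊗₁ idm (B ⊗ D)) ∘ middle_braid X B C D.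
Proof.
rewrite /middle_braid (comp_rewrite _ (assoc_nat _ _ _)) tensm_id !compA.
rewrite -assoc_inv_nat.
have L (P Q : V) (g : hom P Q) :
    (idm Y ⊗₁ g) ∘ (f ⊗₁ idm P) = (f ⊗₁ idm Q) ∘ (idm X ⊗₁ g).
  by rewrite -!tensm_comp !comp_idl !comp_idr.
by rewrite !(comp_rewrite _ (L _ _ _)) !compA !(comp_rewrite _ (L _ _ _)) !compA
  !(comp_rewrite _ (L _ _ _)) !compA tensm_id.
Qed.

(** The diagonal action [(x ⊗ k) h = x h₁ ⊗ k h₂]. *)
Definition diagonal_xi (X : V) (ξ : hom (X ⊗ H) X) :
    hom ((X ⊗ H) ⊗ H) (X ⊗ H) :=
  (ξ ⊗₁ bi_m H) ∘ middle_braid X H H H ∘ (idm (X ⊗ H) ⊗₁ bi_delta H).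

(** The canonical map [β(x ⊗ h) = x h₁ ⊗ h₂]. *)
Definition galois_map (X : V) (ξ : hom (X ⊗ H) X) : hom (X ⊗ H) (X ⊗ H) :=
  T ξ ∘ Δ X.

(** In elements, [(x h₁ ⊗ h₂) k = (x h₁) k₁ ⊗ h₂ k₂ = x (h k)₁ ⊗ (h k)₂].
    The second equality is the compatibility condition of the free Hopf module
    [X ⊗ H] pushed forward along [ξ], which is linear by associativity. *)
Lemma galois_map_linear (X : V) (ξ : hom (X ⊗ H) X) :
  is_right_module (bi_alg H) ξ ->
  diagonal_xi ξ ∘ T (galois_map ξ) = galois_map ξ ∘ μ X.
Proof.
move=> ξP; rewrite /galois_map tens_idr_comp.
rewrite -(compA _ _ (μ X)) free_compat.
(* Sealing these composites keeps associativity from splitting them. *)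
have := @middle_braid_nat_l _ _ H H H ξ; rewrite /diagonal_xi.
move: (middle_braid (X ⊗ H) H H H) (middle_braid X H H H) => b b' nat_b.
have := module_assoc ξP; move: (μ X) (Δ X) => m d assoc_ξ.
rewrite !compA -tensm_comp -assoc_ξ comp_idl.
have -> : (ξ ∘ T ξ) ⊗₁ bi_m H = (ξ ⊗₁ bi_m H) ∘ (T ξ ⊗₁ idm (H ⊗ H)).
  by rewrite -tensm_comp comp_idr.
rewrite (comp_rewrite _ (eq_sym nat_b)) compA.
rewrite !(comp_rewrite _ (eq_sym (tensm_comp _ _ _ _))) !comp_idl.
by rewrite comp_idr.
Qed.

Lemma galois_map_unit (X : V) (ξ : hom (X ⊗ H) X) :
  is_right_module (bi_alg H) ξ -> galois_map ξ ∘ η X = η X.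
Proof.
move=> ξP; rewrite /galois_map -compA free_nu_unit compA -tens_idr_comp.
by rewrite (module_unit ξP) tensm_id comp_idl.
Qed.

Lemma galois_map_nat (X : V) (ξ : hom (X ⊗ H) X) (Y : V) (f : hom Y X) :
  galois_map ξ ∘ T f = T (ξ ∘ T f) ∘ Δ Y.
Proof.
by rewrite /galois_map -compA free_nu_nat compA -tens_idr_comp.
Qed.

(** The Hopf module axiom says that the coaction is linear for the diagonal
    action. *)
Lemma hopf_module_diagonal (X : hopf_module H) :
  hm_nu X ∘ hm_xi X = diagonal_xi (hm_xi X) ∘ T (hm_nu X).
Proof.
rewrite hm_compat /diagonal_xi -!compA; congr (_ ∘ (_ ∘ _)).
by rewrite -tensm_comp comp_idl comp_idr.
Qed.

Lemma hopf_module_iso (X Y : hopf_modules H) (f : hom X Y) :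
  is_iso (hmh_mor f) -> is_iso f.
Proof.
case=> g [gf fg].
have Tfg : T (hmh_mor f) ∘ T g = idm _ by rewrite -tens_idr_comp fg tensm_id.
have Tgf : T g ∘ T (hmh_mor f) = idm _ by rewrite -tens_idr_comp gf tensm_id.
have gm : g ∘ hm_xi Y = hm_xi X ∘ T g.
  by rewrite -[LHS]comp_idr -Tfg compA (comp_rewrite _ (eq_sym (hmh_module f)))
    compA gf comp_idl.
have gc : hm_nu X ∘ g = T g ∘ hm_nu Y.
  rewrite -[LHS]comp_idl -Tgf -(compA (T g)) (compA (T (hmh_mor f))).
  by rewrite -(hmh_comodule f) -(compA _ _ g) fg comp_idr.
by exists (HopfModuleHom gm gc); split; apply: hopf_module_hom_eq.
Qed.

End HopfMonad.

(** * The projection onto coinvariants *)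

Section HopfModules.
Context (V : strict_braided) (H : hopf_algebra V).

Local Notation T f := (f ⊗₁ idm (bi_ob (hopf_bialgebra H))).
Local Notation μ := (@free_xi V H).
Local Notation Δ := (@free_nu V H).
Local Notation η := (@unit_map V H).
Local Notation ϵ := (@counit_map V H).

Definition antipode_map (X : V) : hom (X ⊗ H) (X ⊗ H) :=
  idm X ⊗₁ antipode H.

Local Notation s := antipode_map.

Lemma antipode_map_nat (X Y : V) (f : hom X Y) : s Y ∘ T f = T f ∘ s X.
Proof. by rewrite /s -!tensm_comp !comp_idl !comp_idr. Qed.

Lemma antipode_map_r (X : V) : μ X ∘ s (X ⊗ H) ∘ Δ X = η X ∘ ϵ X.
Proof.
rewrite /free_xi /free_nu /s /η /ϵ -tensm_id !compA.
rewrite (comp_rewrite _ (assoc_nat _ _ _)) !compA.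
rewrite (comp_rewrite _ (assoc_invK _ _ _)) comp_idr -!tens_idl_comp.
rewrite antipode_r tens_idl_comp /runit.
by rewrite (comp_rewrite _ (cast_comp _ _)) cast_id comp_idr.
Qed.

Lemma antipode_map_l (X : V) : μ X ∘ T (s X) ∘ Δ X = η X ∘ ϵ X.
Proof.
rewrite /free_xi /free_nu /s /η /ϵ !compA.
rewrite (comp_rewrite _ (assoc_nat _ _ _)) !compA.
rewrite (comp_rewrite _ (assoc_invK _ _ _)) comp_idr -!tens_idl_comp.
rewrite antipode_l tens_idl_comp /runit.
by rewrite (comp_rewrite _ (cast_comp _ _)) cast_id comp_idr.
Qed.

(** [S(1) = 1], because [S(1) = S(1) 1 = ε(1) 1]. *)
Lemma antipode_map_unit (X : V) : s X ∘ η X = η X.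
Proof.
transitivity (μ X ∘ T (s X) ∘ Δ X ∘ η X); last first.
  by rewrite antipode_map_l (comp_rewrite _ (counit_unit_map _ _)) comp_idr.
rewrite (comp_rewrite _ (free_nu_unit _ _)) compA.
rewrite (comp_rewrite _ (eq_sym (tens_idr_comp _ _ _))).
by rewrite (comp_rewrite _ (unit_map_nat _ _)) compA
  (module_unit (free_module H X)) comp_idl.
Qed.

Section Coinvariants.
Variable X : hopf_module H.
Local Notation ξ := (hm_xi X).
Local Notation ν := (hm_nu X).
Let ξP := hm_module X.
Let νP := hm_comodule X.

Definition coinvariant_projection : hom X X := ξ ∘ s X ∘ ν.
Local Notation p := coinvariant_projection.

(** [x₀ S(x₁) x₂ = x₀ ε(x₁) = x]. *)
Lemma projection_act_coact : ξ ∘ T p ∘ ν = idm X.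
Proof.
rewrite /p !tens_idr_comp; assoc_left.
rewrite (module_assoc ξP) (comp_rewrite _ (comodule_coassoc νP)); assoc_left.
rewrite -(compA ξ) -(compA ξ) antipode_map_l; assoc_left.
by rewrite (module_unit ξP) comp_idl (comodule_counit νP).
Qed.

(** [β(p(x₀) ⊗ x₁) = p(x₀) x₁ ⊗ x₂], where the previous lemma applies to the
    first two factors. *)
Lemma coact_galois : ν = galois_map ξ ∘ T p ∘ ν.
Proof.
rewrite galois_map_nat (comp_rewrite _ (eq_sym (comodule_coassoc νP))).
assoc_left; rewrite -tens_idr_comp projection_act_coact tensm_id.
by rewrite comp_idl.
Qed.

(** By linearity of [ν] and [β], in [ν(x₀ S(x₁)) = β(p(x₀) ⊗ x₁) S(x₂)] the
    last factor can be moved next to [x₁], where the antipode axiom cancels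
    both. *)
Lemma projection_coinvariant : ν ∘ p = η X ∘ p.
Proof.
transitivity (galois_map ξ ∘ μ X ∘ T (T p) ∘ T ν ∘ s X ∘ ν).
  rewrite -(galois_map_linear ξP) /p; assoc_left.
  rewrite hopf_module_diagonal; do 2 congr (_ ∘ _).
  rewrite [in LHS]coact_galois !tens_idr_comp; assoc_left.
  by [].
rewrite (comp_rewrite _ (eq_sym (antipode_map_nat _))); assoc_left.
rewrite (comp_rewrite _ (comodule_coassoc νP)); assoc_left.
rewrite (comp_rewrite _ (eq_sym (antipode_map_nat _))); assoc_left.
rewrite (comp_rewrite _ (eq_sym (free_nu_nat _ _))); assoc_left.
rewrite -(compA _ (μ X)) -(compA (galois_map ξ)) antipode_map_r.
assoc_left; rewrite (galois_map_unit ξP) (comp_rewrite _ (counit_map_nat _ _)).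
by assoc_left; rewrite (comp_rewrite _ (comodule_counit νP)) comp_idr.
Qed.

Section CoinvariantMap.
Variables (E : V) (i : hom E X).
Hypothesis iP : ν ∘ i = η X ∘ i.

(** [x₀ S(x₁) = x S(1) = x] when [ν(x) = x ⊗ 1]. *)
Lemma projection_fixes : p ∘ i = i.
Proof.
rewrite /p (comp_rewrite _ iP); assoc_left.
rewrite (comp_rewrite _ (antipode_map_unit _)).
by rewrite (module_unit ξP) comp_idl.
Qed.

Lemma free_map_linear : ξ ∘ T i ∘ μ E = ξ ∘ T (ξ ∘ T i).
Proof.
rewrite (comp_rewrite _ (eq_sym (free_xi_nat _ _))) tens_idr_comp.
by assoc_left; rewrite (module_assoc ξP).
Qed.

(** A coinvariant [x] satisfies [ν(x) = x ⊗ 1 = β(x ⊗ 1)], and both [ν] and [β]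
    are linear for the diagonal action, so [ν(x h) = β(x ⊗ h)]. *)
Lemma free_map_colinear : ν ∘ (ξ ∘ T i) = T (ξ ∘ T i) ∘ Δ E.
Proof.
rewrite compA hopf_module_diagonal (comp_rewrite _ (eq_sym (tens_idr_comp _ _ _))).
rewrite iP -(galois_map_unit ξP).
rewrite (tens_idr_comp _ (galois_map ξ ∘ _)) (tens_idr_comp _ (galois_map ξ)).
assoc_left.
rewrite (galois_map_linear ξP) (comp_rewrite _ (free_xi_unit _ _)) comp_idr.
by rewrite galois_map_nat tens_idr_comp.
Qed.

(** [p(x h) = x h₁ S(h₂) = x ε(h)], by colinearity. *)
Lemma projection_free_map : p ∘ (ξ ∘ T i) = i ∘ ϵ E.
Proof.
rewrite /p (comp_rewrite _ free_map_colinear); assoc_left.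
rewrite (comp_rewrite _ (antipode_map_nat _)); assoc_left.
rewrite -free_map_linear -(compA _ (μ E)) -(compA (ξ ∘ _)) antipode_map_r.
by assoc_left; rewrite (comp_rewrite _ (unit_map_nat _ _)) compA
  (module_unit ξP) comp_idl.
Qed.
End CoinvariantMap.

(** Coinvariants as a splitting of the projection: the retraction is what the
    later constructions use of the universal property of the equalizer. *)
Record coinvariants := Coinvariants {
  coinv_ob :> V;
  coinv_incl : hom coinv_ob X;
  coinv_retr : hom X coinv_ob;
  coinv_inclP : ν ∘ coinv_incl = η X ∘ coinv_incl;
  coinv_split : coinv_incl ∘ coinv_retr = p;
  coinv_inclK : coinv_retr ∘ coinv_incl = idm coinv_ob
}.

(** The equalizer of [ν] and the unit: [p] factors through it because its
    values are coinvariant. *)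
Lemma coinvariants_exist : has_equalizers V -> exists E : coinvariants, True.
Proof.
move=> V_eq; have [E [i [iP i_univ]]] := V_eq _ _ ν (η X).
have [r [rP _]] := i_univ _ _ projection_coinvariant.
suff ri : r ∘ i = idm E by exists (Coinvariants iP rP ri).
have [j [_ j_uniq]] := i_univ _ _ iP.
rewrite -(j_uniq (r ∘ i)) ?(j_uniq (idm E)) ?comp_idr //.
by rewrite compA rP projection_fixes.
Qed.
End Coinvariants.

(** * The equivalence *)

Section CoinvariantsFunctor.
Variable coinv : forall X : hopf_module H, coinvariants X.

Local Notation i X := (coinv_incl (coinv X)).
Local Notation r X := (coinv_retr (coinv X)).

Lemma coinv_incl_mono (X : hopf_module H) (W : V) (f g : hom W (coinv X)) :
  i X ∘ f = i X ∘ g -> f = g.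
Proof.
by move=> E; rewrite -[f]comp_idl -[g]comp_idl -!(coinv_inclK (coinv X))
  -!compA E.
Qed.

Lemma coinv_incl_retr (X : hopf_module H) (W : V) (f : hom W X) :
  hm_nu X ∘ f = η X ∘ f -> i X ∘ (r X ∘ f) = f.
Proof. by move=> fP; rewrite compA coinv_split projection_fixes. Qed.

Definition coinv_map (X Y : hopf_modules H) (f : hom X Y) :
  hom (coinv X) (coinv Y) := r Y ∘ (hmh_mor f ∘ i X).

Lemma coinv_incl_nat (X Y : hopf_modules H) (f : hom X Y) :
  i Y ∘ coinv_map f = hmh_mor f ∘ i X.
Proof.
apply: coinv_incl_retr; rewrite compA (hmh_comodule f).
rewrite (comp_rewrite _ (coinv_inclP _)) compA.
by rewrite unit_map_nat -compA.
Qed.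

Lemma coinv_map_id (X : hopf_modules H) : coinv_map (idm X) = idm (coinv X : V).
Proof. by rewrite /coinv_map comp_idl coinv_inclK. Qed.

Lemma coinv_map_comp (X Y Z : hopf_modules H) (g : hom Y Z) (f : hom X Y) :
  coinv_map (g ∘ f) = coinv_map g ∘ coinv_map f.
Proof.
apply: coinv_incl_mono; rewrite coinv_incl_nat compA coinv_incl_nat.
by rewrite -compA coinv_incl_nat compA.
Qed.

Definition coinv_functor : functor (hopf_modules H) V :=
  @Functor (hopf_modules H) V (fun X => coinv X) coinv_map
    coinv_map_id coinv_map_comp.

Definition free_coinv_map (X : hopf_modules H) :
  hom (free_hopf_module H (coinv_functor X)) X :=
  @HopfModuleHom V H (free_hopf_module_ob H (coinv X)) X
    (hm_xi X ∘ T (i X))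
    (free_map_linear (X := X) (i X)) (free_map_colinear (coinv_inclP (coinv X))).

(** The inverse is [x ↦ r(x₀) ⊗ x₁]. *)
Lemma free_coinv_map_iso (X : hopf_modules H) : is_iso (free_coinv_map X).
Proof.
apply: hopf_module_iso; exists (T (r X) ∘ hm_nu X); split=> /=.
- rewrite -compA (free_map_colinear (coinv_inclP _)) compA -tens_idr_comp.
  have -> : r X ∘ (hm_xi X ∘ T (i X)) = ϵ (coinv X).
    apply: coinv_incl_mono; rewrite compA coinv_split.
    exact: projection_free_map (coinv_inclP _).
  exact: counit_free_nu.
- rewrite compA (comp_rewrite _ (eq_sym (tens_idr_comp _ _ _))) coinv_split.
  exact: projection_act_coact.
Qed.

Lemma free_coinv_map_nat (X Y : hopf_modules H) (f : hom X Y) :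
  free_coinv_map Y ∘ fmap (free_hopf_module H) (fmap coinv_functor f) =
  f ∘ free_coinv_map X.
Proof.
apply: hopf_module_hom_eq => /=; rewrite compA (hmh_module f).
by rewrite !(comp_rewrite _ (eq_sym (tens_idr_comp _ _ _))) coinv_incl_nat.
Qed.

Definition coinv_free_map (W : V) :
  hom (coinv_functor (free_hopf_module H W)) W :=
  ϵ W ∘ i (free_hopf_module_ob H W).

Lemma coinv_free_map_nat (W W' : V) (f : hom W W') :
  coinv_free_map W' ∘ fmap coinv_functor (fmap (free_hopf_module H) f) =
  f ∘ coinv_free_map W.
Proof.
rewrite /coinv_free_map /= -compA coinv_incl_nat /=; assoc_left.
by rewrite counit_map_nat.
Qed.

(** The inverse corestricts [w ↦ w ⊗ 1], whose values are coinvariant, to the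
    coinvariants. *)
Lemma coinv_free_map_iso (W : V) : is_iso (coinv_free_map W).
Proof.
have uP : i (free_hopf_module_ob H W) ∘ (r (free_hopf_module_ob H W) ∘ η W)
    = η W.
  apply: coinv_incl_retr; rewrite /= free_nu_unit; exact: unit_map_nat.
exists (r (free_hopf_module_ob H W) ∘ η W); split; last first.
  by rewrite /coinv_free_map -compA uP counit_unit_map.
apply: coinv_incl_mono; rewrite compA uP comp_idr /coinv_free_map.
assoc_left; rewrite -unit_map_nat.
have iP := coinv_inclP (coinv (free_hopf_module_ob H W)).
(* Coinvariance turns the unit after [i] into the coaction of [W ⊗ H], which
   the counit cancels. *)
rewrite -(compA _ _ (i _)) -iP /=; assoc_left.
by rewrite counit_free_nu comp_idl.
Qed.

End CoinvariantsFunctor.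

End HopfModules.

Theorem theorem5p18 (V : strict_braided)
  (V_eq : has_equalizers V) (V_coeq : has_coequalizers V)
  (V_tens : tensor_preserves_coequalizers V) (H : hopf_algebra V) :
  is_equivalence (free_hopf_module H).
Proof.
pose coinv (X : hopf_module H) :=
  proj1_sig (constructive_indefinite_description _ (coinvariants_exist X V_eq)).
exists (coinv_functor coinv); split.
- exists (coinv_free_map coinv); split.
  + exact: coinv_free_map_nat.
  + exact: coinv_free_map_iso.
- exists (free_coinv_map coinv); split.
  + exact: free_coinv_map_nat.
  + exact: free_coinv_map_iso.
Qed.
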